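(* For each of the following two properties, there exists a tame Markov chain on the free group $\mathbb{F}_2$ and a starting point $p\in\mathbb{F}_2$ such that the chain $(w_n^p)_n$ started at $p$ satisfies this property. (1) The Markov chain $(w_n^p)_n$ does not have well-defined drift, i.e. the limit $\lim_{n\to\infty}\frac{\mathbb{E}[d(p,w_n^p)]}{n}$ does not exist. (2) The Markov chain $(w_n^p)_n$ has well-defined drift (i.e. the limit $\ell=\lim_{n\to\infty}\frac{\mathbb{E}[d(p,w_n^p)]}{n}$ exists) but does not satisfy a Central Limit Theorem.
   Context: $\mathbb{F}_2$ is the free group of rank 2 and $d$ is the word metric (Cayley graph metric) with respect to its standard (free) generating set. A Markov chain on a group $G$ is a time-homogeneous Markov chain with state space $G$; $p(g,h)$ denotes its one-step transition probability from $g$ to $h$, and $w_n^p$ denotes the position after $n$ steps of the chain started at $p\in G$. A Markov chain on a group $G$ is tame if it satisfies the following three conditions. (i) Bounded jumps: there is a finite set $S\subseteq G$ such that $p(g,h)=\mathbb{P}[w_1^g=h]=0$ if $h\notin gS$. (ii) Non-amenability: there exist $B>0$ and $\rho<1$ such that for all $x,y\in G$ and $n\ge 0$ we have $\mathbb{P}[w_n^x=y]\le B\rho^n$. (iii) Irreducibility: for all $u\in G$ there exist constants $\epsilon_u,K_u>0$ such that for all $g\in G$ we have $\mathbb{P}[w_k^g=gu]\ge\epsilon_u$ for some $k\le K_u$. The drift of $(w_n^p)_n$ is $\lim_{n\to\infty}\mathbb{E}[d(p,w_n^p)]/n$; it is well-defined if this limit exists. A Markov chain $(w_n^p)_n$ with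 well-defined drift $\ell$ satisfies a Central Limit Theorem if there exists a constant $\sigma>0$ such that $(d(p,w_n^p)-\ell n)/(\sigma^2\sqrt{n})$ converges in distribution to the standard normal distribution $\mathcal{N}(0,1)$. *)

(* Defs.v *)
From HB Require Import structures.
From mathcomp Require Import all_boot all_order all_algebra.
From mathcomp Require Import all_classical all_reals all_analysis.

Set Implicit Arguments.
Unset Strict Implicit.
Unset Printing Implicit Defensive.

Import Order.TTheory GRing.Theory Num.Theory.
Import numFieldNormedType.Exports.

Local Open Scope classical_set_scope.
Local Open Scope ring_scope.

(* The free group on [T] is the set of reduced words in the letters            *)
(* [(t, false)], standing for the generator [t], and [(t, true)], standing for *)
(* its inverse; the product reduces the concatenation of two words.            *)
Section FreeGroup.
Variable T : choiceType.
Implicit Types (a b : T * bool) (u v w : seq (T * bool)).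

Definition inv_letter a : T * bool := (a.1, ~~ a.2).

Definition reduced w : bool := sorted (fun a b => b != inv_letter a) w.

Definition push a w :=
  if w is b :: w' then if b == inv_letter a then w' else a :: w else [:: a].

Definition mul_word u v := foldr push v u.

Definition inv_word u := rev (map inv_letter u).

Record free_group := FreeGroup { word : seq (T * bool); _ : reduced word }.

HB.instance Definition _ := [isSub for word].
HB.instance Definition _ := [Choice of free_group by <:].

Lemma inv_letterK : involutive inv_letter.
Proof. by case=> t b; rewrite /inv_letter /= negbK. Qed.

Lemma inv_wordK : involutive inv_word.
Proof.
by move=> u; rewrite /inv_word map_rev revK -map_comp (eq_map inv_letterK) map_id.
Qed.

Lemma push_reduced a w : reduced w -> reduced (push a w).
Proof.
case: w => //= b w; case: eqP => [_|/eqP ba] red_w; first exact: path_sorted red_w.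
by rewrite /reduced /= ba.
Qed.

Lemma pushK a w : reduced w -> push a (push (inv_letter a) w) = w.
Proof.
case: w => [_|b w]; first by rewrite /= eqxx.
rewrite /= inv_letterK; case: eqP => [->|_ _]; last by rewrite /= eqxx.
by case: w => //= c w /andP[/negPf-> _].
Qed.

Lemma mul_word_reduced u v : reduced v -> reduced (mul_word u v).
Proof. by move=> red_v; elim: u => //= a u; exact: push_reduced. Qed.

Lemma mul_word_push a u v :
  reduced v -> mul_word (push a u) v = push a (mul_word u v).
Proof.
case: u => //= b u red_v; case: eqP => [->|//].
by rewrite pushK //; exact: mul_word_reduced.
Qed.

Lemma inv_word_reduced u : reduced u -> reduced (inv_word u).
Proof.
rewrite /reduced /inv_word rev_sorted sorted_map; apply: sub_sorted => a b /=.
by rewrite inv_letterK => ba; rewrite eq_sym.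
Qed.

Definition free_one := @FreeGroup [::] isT.

Definition free_mul (g h : free_group) : free_group :=
  FreeGroup (mul_word_reduced (word g) (valP h)).

Definition free_inv (g : free_group) : free_group :=
  FreeGroup (inv_word_reduced (valP g)).

Lemma free_mulA : associative free_mul.
Proof.
move=> [u red_u] [v red_v] [w red_w]; apply: val_inj => /=.
by elim: u {red_u} => //= a u ->; rewrite mul_word_push.
Qed.

Lemma free_mul1 : left_id free_one free_mul.
Proof. by move=> g; apply: val_inj. Qed.

Lemma free_mulr1 : right_id free_one free_mul.
Proof.
move=> [u red_u]; apply: val_inj => /=.
elim: u red_u => //= a u IHu red_au; rewrite IHu; last exact: path_sorted red_au.
by case: u red_au {IHu} => //= b u /andP[/negPf-> _].
Qed.

Lemma mul_invw u : mul_word (inv_word u) u = [::].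
Proof.
elim: u => //= a u IHu.
rewrite /inv_word /= rev_cons /mul_word foldr_rcons /= inv_letterK eqxx.
exact: IHu.
Qed.

Lemma free_mulV : left_inverse free_one free_inv free_mul.
Proof. by move=> g; apply: val_inj; exact: mul_invw. Qed.

Lemma free_mulrV : right_inverse free_one free_inv free_mul.
Proof.
by move=> g; apply: val_inj; rewrite /= -{1}[word g]inv_wordK mul_invw.
Qed.

HB.instance Definition _ := isGroup.Build free_group
  free_mulA free_mul1 free_mulr1 free_mulV free_mulrV.

Definition free_gen (t : T) : free_group := @FreeGroup [:: (t, false)] isT.

End FreeGroup.

Section WordMetric.
Variables (G : groupType) (A : set G).

Definition spells (s : seq G) (g : G) : Prop :=
  (forall a, a \in s -> A a \/ A (a^-1)%g) /\ (\prod_(a <- s) a)%g = g.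

Definition generates : Prop := forall g, exists s, spells s g.

Hypothesis genA : generates.

Lemma word_length_ex (g : G) :
  exists n, `[< exists s, size s = n /\ spells s g >].
Proof. by have [s sg] := genA g; exists (size s); apply/asboolP; exists s. Qed.

Definition word_length (g : G) : nat := ex_minn (word_length_ex g).

Definition word_dist (g h : G) : nat := word_length (g^-1 * h)%g.

End WordMetric.

Lemma free_gen_generates (T : choiceType) : generates (range (@free_gen T)).
Proof.
pose letter (a : T * bool) : free_group T := @FreeGroup T [:: a] isT.
have prodE (s : seq (T * bool)) :
    word (\prod_(a <- s) letter a)%g = mul_word s [::].
  by elim: s => [|a s IHs]; rewrite ?big_nil // big_cons /= IHs.
move=> g; exists (map letter (word g)); split.
  move=> _ /mapP[[t b] _ ->]; case: b; [right|left]; exists t => //.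
  exact: val_inj.
rewrite big_map; apply: val_inj; rewrite [LHS]prodE.
by have /(congr1 (@word T)) := free_mulr1 g.
Qed.

Definition F2 : groupType := free_group 'I_2.

Definition dF2 : F2 -> F2 -> nat := word_dist (@free_gen_generates 'I_2).

(* The chains started at all states are realized on one probability space:     *)
(* [mc_pos x n] is the position after [n] steps of the chain started at [x].   *)
(* Nothing is assumed on the joint law of chains with distinct starting points.*)
Record markov_chain (R : realType) (G : choiceType) := MarkovChain {
  mc_display : measure_display;
  mc_space : measurableType mc_display;
  mc_prob : probability mc_space R;
  mc_trans : G -> G -> R;
  mc_pos : G -> nat -> mc_space -> G;
  mc_trans_ge0 : forall g h, 0 <= mc_trans g h;
  mc_trans_sum1 : forall g, (\esum_(h in [set: G]) (mc_trans g h)%:E = 1)%E;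
  (* measurability for the discrete sigma-algebra on [G] *)
  mc_pos_measurable : forall x n (E : set G), measurable (mc_pos x n @^-1` E);
  mc_start : forall x, mc_prob [set t | mc_pos x 0 t = x] = 1%E;
  (* time-homogeneous Markov property, in product form so that no conditioning *)
  (* on null events occurs                                                     *)
  mc_markov : forall x n (s : nat -> G),
    (mc_prob [set t | forall i, (i <= n.+1)%N -> mc_pos x i t = s i] =
     mc_prob [set t | forall i, (i <= n)%N -> mc_pos x i t = s i] *
       (mc_trans (s n) (s n.+1))%:E)%E
}.

Arguments mc_pos {R G} _ _ _ _.

Section Tame.
Variables (R : realType) (G : groupType) (X : markov_chain R G).
Local Notation P := (mc_prob X).
Local Notation p := (mc_trans X).
Local Notation w := (mc_pos X).

Definition bounded_jumps : Prop :=
  exists2 S : set G, finite_set S &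
    forall g h, ~ (exists2 s, S s & h = (g * s)%g) -> p g h = 0.

Definition nonamenable : Prop :=
  exists B rho : R, [/\ 0 < B, rho < 1 &
    forall x y n, (P [set t | w x n t = y] <= (B * rho ^+ n)%:E)%E].

Definition irreducible : Prop :=
  forall u : G, exists (eps : R) (K : nat), [/\ 0 < eps, (0 < K)%N &
    forall g, exists2 k, (k <= K)%N &
      (eps%:E <= P [set t | w g k t = (g * u)%g])%E].

Definition tame : Prop := [/\ bounded_jumps, nonamenable & irreducible].

End Tame.

(* Convergence of distribution functions at the continuity points of the       *)
(* limiting one.                                                               *)
Definition cvg_in_distribution (R : realType) d (Omega : measurableType d)
    (P : probability Omega R) (Y : nat -> Omega -> R)
    (mu : probability (measurableTypeR R) R) : Prop :=
  forall r : R, {for r, continuous (fun s : R => mu [set` `]-oo, s]])} ->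
    P [set t | Y n t <= r] @[n --> \oo] --> mu [set` `]-oo, r]].

Section DriftCLT.
Variables (R : realType) (X : markov_chain R F2) (o : F2).
Local Notation P := (mc_prob X).
Local Notation w := (mc_pos X).

Definition dist_start (n : nat) (t : mc_space X) : R := (dF2 o (w o n t))%:R.

Definition drift_is (l : R) : Prop :=
  ('E_P[dist_start n] * (n%:R^-1)%:E @[n --> \oo] --> l%:E)%E.

Definition has_drift : Prop := exists l : R, drift_is l.

(* The normalization is [sigma ^+ 2 * sqrt n], not [sigma * sqrt n]. *)
Definition satisfies_CLT (l : R) : Prop :=
  exists2 sigma : R, 0 < sigma &
    cvg_in_distribution P
      (fun n t => (dist_start n t - l * n%:R) / (sigma ^+ 2 * Num.sqrt n%:R))
      (normal_prob 0 1).

End DriftCLT.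

(* Main.v *)
Require Import Defs.
From mathcomp Require Import all_boot all_order all_algebra.
From mathcomp Require Import all_classical all_reals all_analysis.
From mathcomp Require Import measurable_realfun zify ring lra.

Set Implicit Arguments.
Unset Strict Implicit.
Unset Printing Implicit Defensive.

Import Order.TTheory GRing.Theory Num.Theory.
Import numFieldNormedType.Exports.

Local Open Scope classical_set_scope.
Local Open Scope ring_scope.

(** Both examples are lazy simple random walks on the 4-regular tree: at [g] the
walk multiplies on the right by a uniform letter with probability 1 or 1/2,
according to a predicate [fast] on [F2], and otherwise stays at [g].  The
choice of [fast] is free, because such walks are always tame
([lazy_tame]): seen from any vertex [y], a move goes away with probability at
least 3/4, so [2^-1 ^+ d(y, w_n)] shrinks in mean by a factor at most 15/16 at
each step, which bounds the probability of being at [y].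

Away from the origin the distance to the origin increases in mean by 1/2 per
step in the fast region and by 1/4 in the slow one.

No drift.  Let [fast] alternate between the spherical shells
[100^j <= |g| < 100^(j+1)].  At time [100^(j+1)] the walk has not left the ball
of that radius, and it has spent in expectation only [O(100^j)] steps inside
the ball of radius [100^j] ([time_in_ball_le]); the mean distance divided by
time is therefore close to 1/2 or to 1/4 according to the parity of [j]
([mean_len_shell]).

Drift without Central Limit Theorem.  Let [fast] hold on one half of the tree,
the words that begin with the first generator or its inverse.  The walk is
transient, so it eventually stays in one half, each with positive limit
probability [q0], [q1] ([branch_mass_cvg]), and it has speed 1/2 or 1/4 there.
The mean distance has the rate [l = q0 / 2 + q1 / 4], but no typical trajectory
has that speed: the deviations from [l * n] are of order [n] instead of
[sqrt n].
Concretely, a Central Limit Theorem would force the mean of the distance on the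
fast half to be at most [(l * q0 + 1 - Phi r) * n] up to [o(n)], for every
[r >= 0], whereas it is [q0 / 2 * n] ([two_speed_no_CLT]).

The chains are realized on the unit interval, driven by the digits of a
uniform point.  Every probability and expectation at time [n] is then a finite
average, and equals the [n]-th iterate of the transition operator [step_mean];
the rest of the argument only manipulates this operator. *)

(** * Integer parts of a uniform point *)

Section UniformCells.
Variable R : realType.

Definition unit_interval : probability (measurableTypeR R) R :=
  uniform_prob (ltr01 : 0 < 1 :> R).

(** For [c = b ^ n] and [t] in the unit interval, this integer encodes the first
[n] digits of [t] in base [b]. *)
Definition cell_index (c : nat) (t : R) : nat := Num.truncn (c%:R * t).

Definition cell (c N : nat) : set R := `[N%:R / c%:R, N.+1%:R / c%:R[%classic.

Lemma cellP c N t : (0 < c)%N -> cell c N t -> cell_index c t = N.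
Proof.
move=> c0; rewrite /cell /= in_itv /= => /andP[lo hi].
have c0R : 0 < c%:R :> R by rewrite ltr0n.
apply: truncn_def; rewrite mulrC -ler_pdivrMr// lo /=.
by rewrite -ltr_pdivlMr.
Qed.

Lemma measurable_cell_index c (Q : set nat) : (0 < c)%N ->
  measurable (cell_index c @^-1` Q).
Proof.
move=> c0; have c0R : 0 < c%:R :> R by rewrite ltr0n.
have -> : cell_index c @^-1` Q = \bigcup_(N in Q) (cell_index c @^-1` [set N]).
  by apply/seteqP; split=> [t Qt|t [N QN] /= ->]; [exists (cell_index c t)|].
apply: bigcup_measurable => N _.
case: N => [|N].
  have -> : cell_index c @^-1` [set 0%N] = `]-oo, c%:R^-1[%classic.
    apply/seteqP; split=> t; rewrite /= in_itv /= /cell_index.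
      move=> /eqP; rewrite -leqn0 truncn_le_nat mulrC -ltr_pdivlMr//.
      by rewrite mul1r.
    move=> tc; apply/eqP; rewrite -leqn0 truncn_le_nat mulrC -ltr_pdivlMr//.
    by rewrite mul1r.
  exact: measurable_itv.
have -> : cell_index c @^-1` [set N.+1] = cell c N.+1.
  apply/seteqP; split=> t; last exact: cellP.
  rewrite /cell /= in_itv /= /cell_index => tN.
  rewrite ler_pdivrMr// ltr_pdivlMr// (mulrC t).
  apply/andP; split; last by rewrite -tN truncnS_gt.
  by rewrite -truncn_gt_nat tN.
exact: measurable_itv.
Qed.

Lemma unit_interval_cell c N : (N < c)%N ->
  unit_interval (cell c N) = (c%:R^-1)%:E.
Proof.
move=> Nc; have c0R : 0 < c%:R :> R by rewrite ltr0n; lia.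
have sub t : cell c N t -> 0 <= t <= 1.
  rewrite /cell /= in_itv /= => /andP[lo hi]; apply/andP; split.
    by apply: le_trans lo; rewrite divr_ge0.
  apply/ltW/(lt_le_trans hi); rewrite ler_pdivrMr// mul1r ler_nat//.
rewrite /unit_interval /= /uniform_prob.
rewrite (eq_integral (cst 1%E)); last first.
  by move=> t /set_mem/sub t01; rewrite /uniform_pdf t01 subr0 invr1.
rewrite integral_cst ?mul1e; last exact: measurable_itv.
rewrite [LHS]lebesgue_measure_itv /= lte_fin ltr_pM2r ?invr_gt0//.
rewrite ltr_nat ltnS leqnn.
by rewrite -EFinB -mulrBl -natrB ?leqnSn// subSnn mul1r.
Qed.

Lemma trivIset_cell c : (0 < c)%N -> trivIset setT (cell c).
Proof.
move=> c0; apply/trivIsetP => i j _ _ ij.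
apply/seteqP; split => // t [/(cellP c0) ti /(cellP c0) tj].
by move: ij; rewrite -ti -tj eqxx.
Qed.

(** The [c] cells have total mass 1, so that the integral over their complement
vanishes and the function is constant on each of them. *)
Lemma expectation_cell_index c (f : nat -> R) : (0 < c)%N ->
  (forall N, 0 <= f N) ->
  ('E_unit_interval[f \o cell_index c] =
    (c%:R^-1 * \sum_(0 <= N < c) f N)%:E)%E.
Proof.
move=> c0 f0.
pose D := \big[setU/set0]_(N <- index_iota 0 c) cell c N.
have mcell N : measurable (cell c N : set (measurableTypeR R)).
  exact: measurable_itv.
have mD : measurable (D : set (measurableTypeR R)).
  by apply: bigsetU_measurable.
have mf : measurable_fun setT (f \o cell_index c : measurableTypeR R -> R).
  move=> _ Y mY; rewrite setTI comp_preimage; exact: measurable_cell_index.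
have tr : trivIset [set` index_iota 0 c] (cell c).
  by apply: sub_trivIset (trivIset_cell c0).
have PD : unit_interval D = 1%E.
  have : (\int[unit_interval]_(t in D) cst 1 t = 1)%E.
    rewrite ge0_integral_bigsetU//; last exact: iota_uniq.
    rewrite (@eq_big_seq _ _ _ _ _ _ (fun _ => (c%:R^-1)%:E)).
      rewrite sumEFin sumr_const_nat subn0 -[_ *+ c]mulr_natl mulfV//.
      by rewrite pnatr_eq0; lia.
    move=> N; rewrite mem_index_iota /= => Nc.
    by rewrite integral_cst// mul1e; exact: unit_interval_cell.
  by rewrite integral_cst// mul1e.
have ND : unit_interval (~` D) = 0%E.
  by rewrite probability_setC//  PD subee.
transitivity (\int[unit_interval]_t (f (cell_index c t))%:E)%E.
  by rewrite unlock.
rewrite (_ : integral _ _ _ =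
    \int[unit_interval]_(t in setT `\` ~` D) (f (cell_index c t))%:E)%E;
    last first.
  apply: ge0_negligible_integral => //.
  - exact: measurableC.
  - by apply/measurable_EFinP.
  - by move=> t _; rewrite lee_fin.
rewrite setTD setCK ge0_integral_bigsetU//=; last 3 first.
- exact: iota_uniq.
- by apply/measurable_EFinP/measurable_funTS.
- by move=> t _; rewrite lee_fin.
rewrite mulr_sumr -sumEFin; apply: eq_big_seq => N; rewrite mem_index_iota => Nc.
rewrite (eq_integral (cst (f N)%:E)); last first.
  by move=> t /set_mem /(cellP c0) /= ->.
by rewrite integral_cst//= [X in (_ * X)%E]unit_interval_cell// -EFinM mulrC.
Qed.

Lemma unit_interval_cell_index c (Q : pred nat) : (0 < c)%N ->
  unit_interval [set t | Q (cell_index c t)] =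
    (c%:R^-1 * \sum_(0 <= N < c) (Q N)%:R)%:E.
Proof.
move=> c0; rewrite -(@expectation_cell_index c (fun N => (Q N)%:R))//.
rewrite -(@expectation_indic _ _ _ unit_interval); last first.
  exact: (@measurable_cell_index c [set N | Q N]).
congr ('E__[_])%E; apply/funext => t /=.
by rewrite indicE; congr (nat_of_bool _)%:R; apply/idP/idP; rewrite inE.
Qed.

End UniformCells.

(** * Chains driven by independent uniform digits *)

(** Passing from [n.+1] digits to [n] digits is an integer division. *)
Lemma truncn_divn (R : realType) (b : nat) (y : R) : (0 < b)%N ->
  (Num.truncn (b%:R * y) %/ b)%N = Num.truncn y.
Proof.
move=> b0; have b0R : 0 < b%:R :> R by rewrite ltr0n.
have [y0|y0] := leP 0 y; last first.
  have -> : Num.truncn (b%:R * y) = 0%N.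
    apply/eqP; rewrite -leqn0 truncn_le_nat mulrC -ltr_pdivlMr//.
    by rewrite ltr_pdivlMr//; nra.
  by rewrite div0n; apply/esym/eqP; rewrite -leqn0 truncn_le_nat; lra.
apply/esym/truncn_def.
have /truncn_itv/andP[lo hi] : 0 <= b%:R * y by rewrite mulr_ge0// ltW.
apply/andP; split.
  rewrite -(ler_pM2l b0R); apply: le_trans lo; rewrite -natrM ler_nat mulnC.
  exact: leq_divM.
rewrite -(ltr_pM2l b0R); apply: lt_le_trans hi _.
by rewrite -natrM ler_nat mulnC ltn_ceil.
Qed.

Section StepMean.
Variables (R : realType) (G : choiceType) (D : finType).
Variable step : G -> D -> G.

(** The transition operator of the chain that jumps from [x] to [step x d] for a
uniform [d]; its iterates are the transition operators in several steps. *)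
Definition step_mean (f : G -> R) (x : G) : R :=
  #|D|%:R^-1 * \sum_(d : D) f (step x d).

Lemma step_mean_ge0 f : (forall x, 0 <= f x) -> forall x, 0 <= step_mean f x.
Proof. by move=> f0 x; rewrite mulr_ge0// sumr_ge0. Qed.

Lemma iter_step_mean_le n (f h : G -> R) x : (forall z, f z <= h z) ->
  iter n step_mean f x <= iter n step_mean h x.
Proof.
move=> fh; elim: n x => //= n IH x.
by rewrite ler_wpM2l// ler_sum.
Qed.

Lemma iter_step_mean_cst n (c : R) x : (0 < #|D|)%N ->
  iter n step_mean (fun=> c) x = c.
Proof.
move=> D_gt0; elim: n x => //= n IH x.
rewrite /step_mean (eq_bigr _ (fun d _ => IH _)).
by rewrite sumr_const -(mulr_natl c) mulKf// pnatr_eq0 -lt0n.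
Qed.

Lemma iter_step_mean_ge0 n f x : (forall z, 0 <= f z) ->
  0 <= iter n step_mean f x.
Proof.
by move=> f0; elim: n x => //= n IH x; exact: step_mean_ge0.
Qed.

Lemma iter_step_meanD n (f h : G -> R) x :
  iter n step_mean (fun z => f z + h z) x =
  iter n step_mean f x + iter n step_mean h x.
Proof.
elim: n x => //= n IH x; rewrite /step_mean (eq_bigr _ (fun d _ => IH _)).
by rewrite big_split mulrDr.
Qed.

Lemma iter_step_meanZ n (a : R) (f : G -> R) x :
  iter n step_mean (fun z => a * f z) x = a * iter n step_mean f x.
Proof.
elim: n x => //= n IH x; rewrite /step_mean (eq_bigr _ (fun d _ => IH _)).
by rewrite -mulr_sumr mulrCA.
Qed.

(** Dynkin's formula: if one step increases [f] in mean by [h], the increments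
add up along the trajectory. *)
Lemma dynkin_eq n (f h : G -> R) x :
  (forall z, step_mean f z = f z + h z) ->
  iter n step_mean f x = f x + \sum_(0 <= k < n) iter k step_mean h x.
Proof.
move=> fh; elim: n => [|n IH]; first by rewrite big_geq// addr0.
rewrite big_nat_recr//= addrA -IH -iter_step_meanD -iterS iterSr.
by congr (iter n step_mean _ x); apply/funext.
Qed.

Lemma dynkin_ge n (f h : G -> R) x :
  (forall z, f z + h z <= step_mean f z) ->
  f x + \sum_(0 <= k < n) iter k step_mean h x <= iter n step_mean f x.
Proof.
move=> fh; elim: n => [|n IH]; first by rewrite big_geq// addr0.
rewrite big_nat_recr//= addrA -iterS iterSr.
apply: (le_trans _ (iter_step_mean_le n x fh)).
by rewrite iter_step_meanD lerD2r.
Qed.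

Lemma iter_step_mean_contract n (rho : R) (f : G -> R) x : 0 <= rho ->
  (forall z, step_mean f z <= rho * f z) ->
  iter n step_mean f x <= rho ^+ n * f x.
Proof.
move=> rho0 fh; elim: n => [|n IH]; first by rewrite mul1r.
rewrite iterSr; apply: (le_trans (iter_step_mean_le n x fh)).
by rewrite iter_step_meanZ exprS -mulrA ler_wpM2l.
Qed.

End StepMean.

Section RandomMapping.
Variables (R : realType) (G : choiceType) (D : finType) (d0 : D).
Variable step : G -> D -> G.

Local Notation b := #|D|.

Let b_gt0 : (0 < b)%N. Proof. by apply/card_gt0P; exists d0. Qed.

Definition digit (N : nat) : D := nth d0 (enum D) (N %% b).

(** The [n] digits are packed in [N] with the oldest one most significant: the
quotient by [b] drives the past, the remainder drives the last step. *)
Fixpoint walk (x : G) (n N : nat) : G :=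
  if n is n'.+1 then step (walk x n' (N %/ b)) (digit N) else x.

Definition random_pos (x : G) (n : nat) (t : R) : G :=
  walk x n (cell_index (b ^ n) t).

Local Notation step_mean := (@step_mean R G D step).

Definition digit_mean (n : nat) (f : nat -> R) : R :=
  (b ^ n)%:R^-1 * \sum_(0 <= N < b ^ n) f N.

Lemma digit_meanS n f : digit_mean n.+1 f =
  digit_mean n (fun M => b%:R^-1 * \sum_(0 <= j < b) f (M * b + j)%N).
Proof.
rewrite /digit_mean expnS mulnC big_nat_mul natrM invfM -mulrA; congr (_ * _).
rewrite mulr_sumr; apply: eq_bigr => M _; congr (_ * _).
rewrite -{1}[(M * b)%N]add0n big_addn mulSn addnK.
by apply: eq_bigr => j _; rewrite addnC.
Qed.

Lemma sum_digit (F : D -> nat -> R) M :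
  \sum_(0 <= j < b) F (digit (M * b + j)) ((M * b + j) %/ b)%N =
  \sum_(d : D) F d M.
Proof.
rewrite -[RHS]big_enum /= (big_nth d0) -cardE.
apply: eq_big_nat => j /= jb.
by rewrite /digit modnMDl modn_small// divnMDl// divn_small// addn0.
Qed.

(** Averaging over the last digit, with the others fixed, applies the transition
operator once to the function that is averaged. *)
Lemma digit_mean_walk n f x :
  digit_mean n (f \o walk x n) = iter n step_mean f x.
Proof.
elim: n f => [|n IH] f.
  by rewrite /digit_mean expn0 invr1 mul1r big_nat1.
rewrite digit_meanS iterSr -IH /digit_mean; congr (_ * _).
apply: eq_bigr => M _; congr (_ * _) => /=.
exact: (sum_digit (fun d M' => f (step (walk x n M') d))).
Qed.

Definition step_prob (g h : G) : R := step_mean (fun z => (z == h)%:R) g.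

Lemma step_prob_ge0 g h : 0 <= step_prob g h.
Proof. exact: step_mean_ge0. Qed.

Lemma step_prob_sum1 g : (\esum_(h in [set: G]) (step_prob g h)%:E = 1)%E.
Proof.
under eq_esum do
  rewrite /step_prob /step_mean mulr_sumr -sumEFin.
rewrite esum_sum; last by move=> h d _ _; rewrite lee_fin mulr_ge0.
rewrite (eq_bigr (fun _ => (b%:R^-1)%:E)).
  rewrite sumEFin sumr_const -[_ *+ _]mulr_natl mulfV//.
  by rewrite pnatr_eq0 -lt0n.
move=> d _; transitivity (\esum_(h in [set step g d]) (b%:R^-1 : R)%:E)%E.
  rewrite [RHS]esum_mkcond; apply: eq_esum => h _.
  have [->|ne] := eqVneq (step g d) h; first by rewrite mulr1 mem_set.
  by rewrite mulr0 memNset// => /esym/eqP; rewrite (negPf ne).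
by rewrite esum_set1// lee_fin.
Qed.

Lemma random_pos_measurable x n (E : set G) :
  measurable (random_pos x n @^-1` E : set (measurableTypeR R)).
Proof.
rewrite [X in measurable X](_ : _ =
  cell_index (b ^ n) @^-1` (walk x n @^-1` E))//.
by apply: measurable_cell_index; rewrite expn_gt0 b_gt0.
Qed.

Lemma random_pos_start x :
  unit_interval R [set t | random_pos x 0 t = x] = 1%E.
Proof.
rewrite [X in unit_interval R X](_ : _ = setT) ?probability_setT//.
exact/seteqP.
Qed.

(** A whole trajectory up to time [n] is a function of the digits at time [n],
since the earlier digit blocks are quotients of the last one; this makes the
trajectory events finite unions of cells. *)
Fixpoint follows (x : G) (s : nat -> G) (n N : nat) : bool :=
  if n is n'.+1 then
    follows x s n' (N %/ b) && (walk x n N == s n)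
  else x == s 0%N.

Lemma follows_end x s n N : follows x s n N -> walk x n N = s n.
Proof. by case: n => [/eqP|n /andP[_ /eqP]]. Qed.

Lemma cell_index_divn n t :
  (cell_index (b ^ n.+1) t %/ b)%N = cell_index (R := R) (b ^ n) t.
Proof. by rewrite /cell_index expnS natrM -mulrA truncn_divn. Qed.

Lemma followsP x s n t :
  (forall i, (i <= n)%N -> random_pos x i t = s i) <->
  follows x s n (cell_index (b ^ n) t).
Proof.
elim: n => [|n IH].
  split=> [/(_ 0%N isT) xs|/eqP xs i]; first exact/eqP.
  by rewrite leqn0 => /eqP->.
rewrite [follows _ _ _ _]/= cell_index_divn; split=> [H|/andP[/IH H /eqP E] i].
  apply/andP; split; first by apply/IH => i i_n; apply: H; exact: leqW.
  by apply/eqP; rewrite -(H n.+1 (leqnn _)) /random_pos /= cell_index_divn.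
rewrite leq_eqVlt ltnS => /predU1P[->|]; last exact: H.
by rewrite /random_pos /= cell_index_divn.
Qed.

Lemma prob_follows x s n :
  unit_interval R [set t | forall i, (i <= n)%N -> random_pos x i t = s i] =
  (digit_mean n (fun N => (follows x s n N)%:R))%:E.
Proof.
rewrite /digit_mean -unit_interval_cell_index ?expn_gt0 ?b_gt0//.
by congr (unit_interval R _); apply/seteqP; split=> t /= /followsP.
Qed.

Lemma random_pos_markov x n (s : nat -> G) :
  (unit_interval R [set t | forall i, (i <= n.+1)%N -> random_pos x i t = s i] =
   unit_interval R [set t | forall i, (i <= n)%N -> random_pos x i t = s i] *
     (step_prob (s n) (s n.+1))%:E)%E.
Proof.
rewrite !prob_follows -EFinM digit_meanS /digit_mean -[in RHS]mulrA.
congr (_ * _)%:E; rewrite mulr_suml; apply: eq_bigr => M _ /=.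
rewrite (sum_digit (fun d M' =>
  (follows x s n M' && (step (walk x n M') d == s n.+1))%:R)).
have [/follows_end E|_] := boolP (follows x s n M); last first.
  by rewrite /= big1// mulr0 mul0r.
by rewrite mul1r /step_prob /step_mean E.
Qed.

(** The chains from all starting points are driven by the same digits. *)
Definition random_mapping_chain : markov_chain R G :=
  @MarkovChain R G _ _ (unit_interval R) step_prob random_pos
    step_prob_ge0 step_prob_sum1 random_pos_measurable random_pos_start
    random_pos_markov.

Local Notation X := random_mapping_chain.

Lemma prob_random_mapping (Q : pred G) x n :
  mc_prob X [set t | Q (mc_pos X x n t)] =
  (iter n step_mean (fun z => (Q z)%:R) x)%:E.
Proof.
rewrite -digit_mean_walk /digit_mean -unit_interval_cell_index//.
by rewrite expn_gt0 b_gt0.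
Qed.

Lemma expectation_random_mapping (f : G -> R) x n : (forall z, 0 <= f z) ->
  ('E_(mc_prob X)[f \o mc_pos X x n] = (iter n step_mean f x)%:E)%E.
Proof.
move=> f0; rewrite -digit_mean_walk /digit_mean -expectation_cell_index//.
  by rewrite expn_gt0 b_gt0.
by move=> N /=.
Qed.

End RandomMapping.

(** * Reduced words and the word metric *)

Section FreeGroupWords.
Variable T : choiceType.
Implicit Types (a b : T * bool) (u v : seq (T * bool)) (g h : free_group T).

Definition letter a : free_group T := @FreeGroup T [:: a] isT.

Definition len g : nat := size (word g).

Lemma word_mulg g h : word (g * h)%g = mul_word (word g) (word h).
Proof. by []. Qed.

Lemma mul_word_cat u v : reduced (u ++ v) -> mul_word u v = u ++ v.
Proof.
elim: u => //= a u IHu red; rewrite IHu; last exact: path_sorted red.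
by case: (u ++ v) red => //= b w /andP[/negPf-> _].
Qed.

Lemma reduced_rcons2 u b a :
  reduced (rcons (rcons u b) a) = reduced (rcons u b) && (a != inv_letter b).
Proof.
by case: u => [|c u]; rewrite /reduced /= ?andbT// rcons_path last_rcons.
Qed.

Lemma word_mul_letter_nil g a : word g = [::] -> word (g * letter a)%g = [:: a].
Proof. by rewrite word_mulg => ->. Qed.

(** Right multiplication by a letter acts at the far end of a reduced word: it is
a step along an edge of the tree, backwards for exactly one letter. *)
Lemma word_mul_letter_rcons g u b a : word g = rcons u b ->
  word (g * letter a)%g =
    if a == inv_letter b then u else rcons (rcons u b) a.
Proof.
move=> gE; have red : reduced (rcons u b) by rewrite -gE; exact: valP.
rewrite word_mulg gE; case: eqP => [->|/eqP ne]; last first.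
  by rewrite -[in RHS]cats1 mul_word_cat// cats1 reduced_rcons2 red.
rewrite /mul_word foldr_rcons /= eqxx.
suff red_u : reduced u by rewrite -[RHS]cats0 -mul_word_cat ?cats0.
by move: red; rewrite -cats1 /reduced => /cat_sorted2[].
Qed.

Lemma word_nil g : word g = [::] -> g = 1%g.
Proof. by move=> gE; apply: val_inj. Qed.

Lemma len_eq0 g : (len g == 0)%N = (g == 1%g).
Proof.
apply/idP/eqP => [|->//]; rewrite /len size_eq0 => /eqP; exact: word_nil.
Qed.

Lemma len_mul_le g h : (len (g * h)%g <= len g + len h)%N.
Proof.
rewrite /len word_mulg; elim: (word g) => //= a u IHu.
apply: (@leq_trans (size (mul_word u (word h))).+1); last by rewrite ltnS.
case: (mul_word _ _) => //= b w; case: ifP => //= _.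
by apply: leqW; exact: leqnSn.
Qed.

Lemma len_inv g : len (g^-1)%g = len g.
Proof. by rewrite /len /= /inv_word size_rev size_map. Qed.

Lemma word_prod_letters (s : seq (T * bool)) :
  word (\prod_(a <- s) letter a)%g = mul_word s [::].
Proof. by elim: s => [|a s IHs]; rewrite ?big_nil // big_cons /= IHs. Qed.

Lemma prod_word g : (\prod_(a <- word g) letter a)%g = g.
Proof.
apply: val_inj; rewrite [LHS]word_prod_letters mul_word_cat ?cats0//.
exact: valP.
Qed.

Lemma word_length_free g : word_length (@free_gen_generates T) g = len g.
Proof.
rewrite /word_length; case: ex_minnP => n /asboolP[s [<- [genS prodE]]] minS.
apply/eqP; rewrite eqn_leq; apply/andP; split.
  apply: minS; apply/asboolP; exists (map letter (word g)).
  rewrite size_map; split=> //; split; last by rewrite big_map prod_word.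
  move=> _ /mapP[[t b] _ ->]; case: b; [right|left]; exists t => //.
  exact: val_inj.
rewrite -prodE; elim: s genS {minS prodE} => [|a s IHs] genS.
  by rewrite big_nil.
rewrite big_cons; apply: leq_trans (len_mul_le _ _) _.
have len_a : len a = 1%N.
  by have [[t _ <-//]|[t _ aE]] := genS a (mem_head _ _); rewrite -len_inv -aE.
rewrite len_a ltnS IHs// => c cs; apply: genS; rewrite inE cs orbT//.
Qed.

End FreeGroupWords.

Lemma dF2E (x y : F2) : dF2 x y = len (x^-1 * y)%g.
Proof. exact: word_length_free. Qed.

Notation letters := ('I_2 * bool)%type.

(** Of the four edges at a vertex other than the root, one leads towards the
root and three away from it. *)
Lemma sum_letter_len (R : pzRingType) (f : nat -> R) (g : F2) :
  \sum_(a : letters) f (len (g * letter a)%g) =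
  if len g is n.+1 then f n + f n.+2 *+ 3 else f 1%N *+ 4.
Proof.
have cardL : #|{: letters}| = 4%N by rewrite card_prod card_ord card_bool.
case gE: (word g) / lastP => [|u b]; rewrite {2}/len gE ?size_rcons /=.
  rewrite (eq_bigr (fun=> f 1%N)) ?sumr_const ?cardL// => a _.
  by rewrite /len word_mul_letter_nil.
have E a : len (g * letter a)%g =
    if a == inv_letter b then size u else (size u).+2.
  by rewrite /len (word_mul_letter_rcons _ gE); case: ifP; rewrite ?size_rcons.
rewrite (bigD1 (inv_letter b)) //= E eqxx; congr (_ + _).
rewrite (eq_bigr (fun=> f (size u).+2)); last by move=> a /negPf; rewrite E => ->.
by rewrite sumr_const cardC1 cardL.
Qed.

(** * Lazy walks on the tree are tame *)

Section LazyWalk.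
Variables (R : realType) (fast : F2 -> bool).

(** The coin [d.1] decides whether a walk at a slow vertex moves; the direction
[d.2] is uniform in all cases, and this uniformity gives tameness for every
[fast]. *)
Definition lazy_step (g : F2) (d : bool * letters) : F2 :=
  if d.1 || fast g then (g * letter d.2)%g else g.

Definition lazy_walk : markov_chain R F2 :=
  random_mapping_chain R (false, (ord0, false)) lazy_step.

Local Notation M := (@step_mean R _ _ lazy_step).

(** The probability of each of the four neighbours. *)
Definition rate (g : F2) : R := if fast g then 4^-1 else 8^-1.

(** The generator of the walk is [rate] times the Laplacian of the tree. *)
Lemma lazy_meanE (f : F2 -> R) g :
  M f g = f g + rate g * (\sum_(a : letters) f (g * letter a)%g - f g *+ 4).
Proof.
rewrite /step_mean /rate (_ : \sum_d _ =
    \sum_(c : bool) \sum_(a : letters) f (lazy_step g (c, a))); last first.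
  by rewrite pair_bigA; apply: eq_bigr => -[].
rewrite big_bool !card_prod card_ord card_bool /lazy_step /=.
case: (fast g); first by field.
by rewrite sumr_const card_prod card_ord card_bool; field.
Qed.

Lemma lazy_mean_radial (f : nat -> R) (y g : F2) :
  M (fun z => f (len (y^-1 * z)%g)) g =
  f (len (y^-1 * g)%g) + rate g *
    if len (y^-1 * g)%g is n.+1 then f n + f n.+2 *+ 3 - f n.+1 *+ 4
    else (f 1%N - f 0%N) *+ 4.
Proof.
rewrite lazy_meanE; congr (_ + _ * _).
under eq_bigr do rewrite mulgA.
rewrite (@sum_letter_len R f (y^-1 * g)%g).
by case: len => // ; rewrite mulrnBl.
Qed.

Lemma rate_bounds g : 8^-1 <= rate g <= 4^-1.
Proof. by rewrite /rate; case: ifP => _; lra. Qed.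

(** A move multiplies [2^-1 ^+ d(y, g)] in mean by 3/4 * 1/2 + 1/4 * 2 = 7/8 when
[g] differs from [y], by 1/2 when [g = y], and it happens with probability at
least 1/2. *)
Lemma lazy_mean_half_len (y g : F2) :
  M (fun z => 2^-1 ^+ len (y^-1 * z)%g) g <=
  15 / 16 * 2^-1 ^+ len (y^-1 * g)%g.
Proof.
rewrite (lazy_mean_radial (fun n => 2^-1 ^+ n)).
have /andP[r1 r2] := rate_bounds g.
case: len => [|n]; first by rewrite expr0 expr1; lra.
rewrite !exprS; have : 0 <= 2^-1 ^+ n :> R by rewrite exprn_ge0.
by set q := 2^-1 ^+ n; nra.
Qed.

Lemma iter_half_len n (x y : F2) :
  iter n M (fun z => 2^-1 ^+ len (y^-1 * z)%g) x <= (15 / 16) ^+ n.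
Proof.
apply: le_trans (iter_step_mean_contract _ _ _ (lazy_mean_half_len y)) _.
  by lra.
apply: ler_piMr; first by apply: exprn_ge0; lra.
by apply: exprn_ile1; lra.
Qed.

Lemma prob_lazy_eq (x y : F2) n :
  mc_prob lazy_walk [set t | mc_pos lazy_walk x n t = y] =
  (iter n M (fun z => (z == y)%:R) x)%:E.
Proof.
rewrite -(prob_random_mapping R (false, (ord0, false)) _ (pred1 y)).
by congr (mc_prob lazy_walk _); apply/seteqP; split=> t /eqP.
Qed.

Lemma lazy_bounded_jumps : bounded_jumps lazy_walk.
Proof.
exists ([set 1%g] `|` range (@letter 'I_2)).
  rewrite finite_setU; split; first exact: finite_set1.
  by apply: finite_image; exact: finite_finset.
move=> g h nS; rewrite /= /step_prob /step_mean big1 ?mulr0// => d _.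
case: eqP => // gdh; case: nS; rewrite -gdh /lazy_step; case: ifP => _.
  by exists (letter d.2) => //; right; exists d.2.
by exists 1%g; [left|rewrite mulg1].
Qed.

Lemma lazy_nonamenable : nonamenable lazy_walk.
Proof.
exists 1, (15 / 16); split; [lra|lra|move=> x y n].
rewrite prob_lazy_eq lee_fin mul1r; apply: le_trans (iter_half_len n x y).
apply: iter_step_mean_le => z; case: eqP => [->|_]; last by rewrite exprn_ge0.
by rewrite mulVg.
Qed.

Lemma lazy_mean_letter_ge (f : F2 -> R) g a : (forall z, 0 <= f z) ->
  8^-1 * f (g * letter a)%g <= M f g.
Proof.
move=> f0; rewrite /step_mean !card_prod card_ord card_bool.
rewrite ler_wpM2l// (bigD1 (true, a))//= /lazy_step/= lerDl.
by rewrite sumr_ge0.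
Qed.

Lemma lazy_irreducible : irreducible lazy_walk.
Proof.
move=> u; exists (8^-1 ^+ len u), (len u).+1; split => //.
move=> g; exists (len u); first exact: leqnSn.
rewrite prob_lazy_eq lee_fin -{3}[u]prod_word /len.
elim: (word u) g => [|a v IH] g /=.
  by rewrite big_nil mulg1 eqxx.
rewrite big_cons mulgA exprS.
apply: (le_trans _ (lazy_mean_letter_ge g a _)).
  by rewrite ler_wpM2l// IH.
by move=> z; apply: iter_step_mean_ge0 => w; rewrite ler0n.
Qed.

Lemma lazy_tame : tame lazy_walk.
Proof.
by split; [exact: lazy_bounded_jumps|exact: lazy_nonamenable|
  exact: lazy_irreducible].
Qed.

Lemma dist_start_lazy n t :
  dist_start (X := lazy_walk) 1%g n t = (len (mc_pos lazy_walk 1%g n t))%:R.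
Proof. by rewrite /dist_start dF2E invg1 mul1g. Qed.

Lemma expectation_dist_lazy n :
  ('E_(mc_prob lazy_walk)[dist_start (X := lazy_walk) 1%g n] =
   (iter n M (fun z => (len z)%:R) 1%g)%:E)%E.
Proof.
rewrite -(expectation_random_mapping (false, (ord0, false)))//.
by congr ('E__[_])%E; apply/funext => t; rewrite dist_start_lazy.
Qed.

End LazyWalk.

(** * A lazy walk without drift *)

Section LazyWalkFromOrigin.
Variables (R : realType) (fast : F2 -> bool).
Local Notation M := (@step_mean R _ _ (lazy_step fast)).
Local Notation rate := (rate R fast).

Lemma lazy_mean_len (f : nat -> R) (g : F2) :
  M (fun z => f (len z)) g =
  f (len g) + rate g *
    if len g is n.+1 then f n + f n.+2 *+ 3 - f n.+1 *+ 4
    else (f 1%N - f 0%N) *+ 4.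
Proof.
have := lazy_mean_radial fast f 1%g g; rewrite invg1 mul1g => <-.
by congr (step_mean _ _ g); apply/funext => z; rewrite mul1g.
Qed.

Lemma len_lazy_step g d : (len (lazy_step fast g d) <= (len g).+1)%N.
Proof.
rewrite /lazy_step; case: ifP => _ //.
by apply: leq_trans (len_mul_le _ _) _; rewrite addn1.
Qed.

Lemma iter_lazy_mean_le_ball n (f h : F2 -> R) x :
  (forall z, (len z <= len x + n)%N -> f z <= h z) ->
  iter n M f x <= iter n M h x.
Proof.
elim: n x => [|n IH] x fh; first by apply: fh; rewrite addn0.
rewrite !iterS /step_mean ler_wpM2l//; apply: ler_sum => d _.
apply: IH => z zx; apply: fh; apply: leq_trans zx _.
by rewrite addnS -addSn leq_add2r len_lazy_step.
Qed.

(** The increments are 1 inside the ball of radius [m], where the subtraction of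
naturals truncates the exponent to 0, and decrease geometrically outside.  An
increment [u d] is at least half the previous one, so that
[3 * u d - u (d - 1)] is nonnegative and the walk never decreases the
potential in mean; yet the potential is bounded. *)
Definition escape_potential (m d : nat) : R :=
  \sum_(0 <= j < d) 2^-1 ^+ (j.+1 - m).

Lemma escape_potentialS m d :
  escape_potential m d.+1 = escape_potential m d + 2^-1 ^+ (d.+1 - m).
Proof. by rewrite /escape_potential big_nat_recr. Qed.

Lemma escape_potential_le m d : escape_potential m d <= m%:R + 1.
Proof.
suff: escape_potential m d + 2^-1 ^+ (d - m) <= (minn d m)%:R + 1.
  have : 0 <= 2^-1 ^+ (d - m) :> R by rewrite exprn_ge0.
  have : (minn d m)%:R <= m%:R :> R by rewrite ler_nat geq_minr.
  lra.
elim: d => [|d IH]; first by rewrite /escape_potential big_geq// expr0 min0n.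
rewrite escape_potentialS; have [md|dm] := leqP m d.
  move: IH; rewrite subSn// exprS !(minn_idPr _)// ?(leq_trans md)//.
  by move: (_ ^+ _) => q; lra.
move: IH; rewrite (_ : d.+1 - m = 0)%N; last by lia.
rewrite (_ : d - m = 0)%N; last by lia.
by rewrite !(minn_idPl _) ?(ltnW dm)// expr0 -natr1; lra.
Qed.

Lemma lazy_mean_escape_potential m g : (0 < m)%N ->
  escape_potential m (len g) + 4^-1 * (len g < m)%:R <=
  M (fun z => escape_potential m (len z)) g.
Proof.
move=> m0; rewrite lazy_mean_len lerD2l.
have /andP[r1 _] := rate_bounds R fast g.
case: (len g) => [|n].
  rewrite m0 /escape_potential big_nat1 big_geq// (_ : 1 - m = 0)%N; last by lia.
  by rewrite expr0 /=; lra.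
rewrite !escape_potentialS; move: (escape_potential m n) => v.
have [nm|mn] := ltnP n.+1 m.
  rewrite (_ : n.+2 - m = 0)%N; last by lia.
  rewrite (_ : n.+1 - m = 0)%N; last by lia.
  by rewrite expr0 /=; lra.
rewrite (subSn mn) exprS /= mulr0.
have : 0 <= 2^-1 ^+ (n.+1 - m) :> R by rewrite exprn_ge0.
by move: (_ ^+ _) => q q0; apply: mulr_ge0; lra.
Qed.

(** Each step from inside the ball raises [escape_potential] in mean by at least
1/4, while its total increase is at most [m + 1]. *)
Lemma time_in_ball_le m n : (0 < m)%N ->
  \sum_(0 <= k < n) iter k M (fun z => (len z < m)%:R) 1%g <= 4 * (m%:R + 1).
Proof.
move=> m0.
have := dynkin_ge n 1%g (fun z => lazy_mean_escape_potential z m0).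
under eq_bigr do rewrite iter_step_meanZ.
rewrite -mulr_sumr /= [escape_potential _ 0]big_geq// add0r.
have : iter n M (fun z => escape_potential m (len z)) 1%g <= m%:R + 1.
  rewrite -(iter_step_mean_cst (lazy_step fast) n (m%:R + 1) 1%g); last first.
    by rewrite card_prod card_bool card_prod card_ord card_bool.
  by apply: iter_step_mean_le => z; exact: escape_potential_le.
lra.
Qed.

Lemma drift_isE l : drift_is (lazy_walk R fast) 1%g l <->
  iter n M (fun z => (len z)%:R) 1%g / n%:R @[n --> \oo] --> l.
Proof.
rewrite /drift_is.
under eq_fun do rewrite expectation_dist_lazy -EFinM.
split; first by move/fine_cvg.
by apply: cvg_EFin; exact: nearW.
Qed.

End LazyWalkFromOrigin.

Section NoDrift.
Variable R : realType.

(** The thickness ratio 100 of the shells makes the time spent before reaching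
the outermost shell negligible with respect to the gap between the speeds. *)
Definition shell (g : F2) : nat := trunc_log 100 (len g).
Definition shell_fast (g : F2) : bool := odd (shell g).

Local Notation M := (@step_mean R _ _ (lazy_step shell_fast)).

(** Up to time [100 ^ j.+1] the walk lies in the shells of index at most [j], and
it gains [c] per step in the shell [j].  The inner ball of radius [m = 100 ^ j]
contributes an error at most its occupation time [4 * (m + 1) <= 8 * m], to be
divided by [100 * m]. *)
Lemma mean_len_shell j (c : R) : c = (if odd j then 2^-1 else 4^-1) ->
  `|iter (100 ^ j.+1) M (fun z => (len z)%:R) 1%g / (100 ^ j.+1)%:R - c| <=
  8 / 100.
Proof.
move=> cE; set n := (100 ^ j.+1)%N; pose m := (100 ^ j)%N.
have m0 : (0 < m)%N by rewrite expn_gt0.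
pose h z : R := rate R shell_fast z * (2 + 2 * (len z == 0)%:R).
have hE z : M (fun z => (len z)%:R) z = (len z)%:R + h z.
  rewrite (lazy_mean_len _ (fun k => k%:R)) /h; congr (_ + _ * _).
  by case: len => [|k] /=; [lra|rewrite -[k.+2%:R]natr1 -[k.+1%:R]natr1; lra].
have hc z : (len z < n)%N -> `|h z - c| <= (len z < m)%:R.
  move=> zn; have [zm|mz] := ltnP (len z) m.
    have /andP[] := rate_bounds R shell_fast z.
    rewrite /h cE ler_norml; case: (_ == _); case: odd => /=; lra.
  rewrite /h /rate /shell_fast /shell (@trunc_log_eq 100 j (len z)) -/m ?mz ?zn//.
  rewrite (_ : (len z == 0)%N = false); last by lia.
  rewrite cE normr_le0 mulr0 addr0; case: odd; apply/eqP; lra.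
have len_n : iter n M (fun z => (len z)%:R) 1%g =
    \sum_(0 <= k < n) iter k M h 1%g.
  by rewrite (dynkin_eq _ _ hE) add0r.
have card8 : (0 < #|{: bool * letters}|)%N.
  by rewrite card_prod card_bool card_prod card_ord card_bool.
pose b k := iter k M (fun z => (len z < m)%:R : R) 1%g.
have bound k : (k < n)%N -> c - b k <= iter k M h 1%g <= c + b k.
  move=> kn; apply/andP; split.
    rewrite lerBlDr -iter_step_meanD.
    rewrite -{1}(iter_step_mean_cst (lazy_step shell_fast) k c 1%g)//.
    apply: iter_lazy_mean_le_ball => z zk.
    have := hc z (leq_ltn_trans zk kn); rewrite ler_norml; lra.
  rewrite -{1}(iter_step_mean_cst (lazy_step shell_fast) k c 1%g)//.
  rewrite -iter_step_meanD; apply: iter_lazy_mean_le_ball => z zk.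
  have := hc z (leq_ltn_trans zk kn); rewrite ler_norml; lra.
have sum_b : \sum_(0 <= k < n) b k <= 4 * (m%:R + 1) by exact: time_in_ball_le.
have nE : n%:R = 100 * m%:R :> R by rewrite /n expnS natrM.
have mR : 1 <= m%:R :> R by rewrite ler1n.
have lo : n%:R * c - \sum_(0 <= k < n) b k <= \sum_(0 <= k < n) iter k M h 1%g.
  rewrite -[n%:R * c](_ : \sum_(0 <= k < n) c = _); last first.
    by rewrite sumr_const_nat subn0 mulr_natl.
  rewrite -sumrB; apply: ler_sum_nat => k /= kn.
  by have /andP[] := bound k kn.
have hi : \sum_(0 <= k < n) iter k M h 1%g <= n%:R * c + \sum_(0 <= k < n) b k.
  rewrite -[n%:R * c](_ : \sum_(0 <= k < n) c = _); last first.
    by rewrite sumr_const_nat subn0 mulr_natl.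
  rewrite -big_split; apply: ler_sum_nat => k /= kn.
  by have /andP[] := bound k kn.
rewrite len_n ler_norml; have n0 : 0 < n%:R :> R by lra.
apply/andP; split.
  by rewrite lerBrDr ler_pdivlMr//; lra.
by rewrite lerBlDr ler_pdivrMr//; lra.
Qed.

Lemma shell_walk_no_drift : ~ has_drift (lazy_walk R shell_fast) 1%g.
Proof.
move=> [l /drift_isE /cvgrPdist_lt /(_ (1 / 50))].
have e0 : 0 < 1 / 50 :> R by lra.
move=> /(_ e0)[N _ HN].
have big j : (N <= j)%N -> (N <= 100 ^ j.+1)%N.
  move=> Nj; apply: leq_trans Nj _; apply: ltnW.
  by apply: leq_trans (ltnSn j) _; apply: ltnW; exact: ltn_expl.
have N1 : (N <= N.*2)%N by lia.
have N2 : (N <= N.*2.+1)%N by lia.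
have := HN _ (big _ N1); have := HN _ (big _ N2).
have := @mean_len_shell N.*2 _ erefl.
have := @mean_len_shell N.*2.+1 _ erefl.
rewrite /= odd_double /= !ler_norml !ltr_norml.
set x := iter _ _ _ _ / _; set y := iter _ _ _ _ / _; lra.
Qed.

End NoDrift.

(** * The normal distribution function *)

Section NormalDistributionFunction.
Variable R : realType.
Local Notation Phi r := (normal_prob (0 : R) (1 : R) `]-oo, r]).

(** The density is bounded, so the distribution function is Lipschitz. *)
Lemma normal_prob_itv_le (a b : R) : a <= b ->
  (normal_prob (0 : R) 1 `]a, b] <= (normal_peak 1 * (b - a))%:E)%E.
Proof.
move=> ab; rewrite /normal_prob.
apply: (@le_trans _ _ (\int[lebesgue_measure]_(x in `]a, b])
    (cst (normal_peak (1 : R))%:E x))%E).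
  apply: ge0_le_integral => //=.
  - by move=> x _; rewrite lee_fin normal_pdf_ge0.
  - by apply/measurable_EFinP/measurable_funTS; exact: measurable_normal_pdf.
  - by move=> x _; rewrite lee_fin normal_pdf_ub// oner_eq0.
rewrite integral_cst//= lebesgue_measure_itv/= lte_fin.
case: ltP => [_|ba]; first by rewrite -EFinB -EFinM.
by rewrite mule0 lee_fin mulr_ge0 ?normal_peak_ge0// subr_ge0.
Qed.

Lemma normal_cdf_fin r : Phi r \is a fin_num.
Proof. by rewrite fin_num_measure. Qed.

Lemma normal_cdf_incr (a b : R) : a <= b ->
  fine (Phi a) <= fine (Phi b) <= fine (Phi a) + normal_peak 1 * (b - a).
Proof.
move=> ab; have E : (Phi b = Phi a + normal_prob (0 : R) 1 `]a, b])%E.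
  rewrite -measureU//=; last first.
    apply/seteqP; split=> x //=; rewrite !in_itv/= => -[xa /andP[ax _]].
    by move: xa; rewrite leNgt ax.
  congr (normal_prob _ _ _); apply/seteqP; split=> x /=; rewrite !in_itv/=.
    by move=> xb; case: (leP x a) => [|xa]; [left|right].
  by move=> [xa|/andP[_ ->//]]; exact: le_trans ab.
have f2 : normal_prob (0 : R) 1 `]a, b] \is a fin_num by rewrite fin_num_measure.
have FE : fine (Phi b) = fine (Phi a) + fine (normal_prob (0 : R) 1 `]a, b]).
  by rewrite E; apply: fineD => //; exact: normal_cdf_fin.
rewrite FE lerDl lerD2l fine_ge0//=.
by rewrite -lee_fin fineK// normal_prob_itv_le.
Qed.

Lemma normal_cdf_continuous (r : R) :
  {for r, continuous (fun s : R => Phi s)}.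
Proof.
have K0 : 0 <= normal_peak (1 : R) by exact: normal_peak_ge0.
pose K : R := normal_peak 1 + 1.
rewrite /prop_for /continuous_at -[Phi r]fineK ?normal_cdf_fin//.
apply: cvg_EFin; first by apply: nearW => s; exact: normal_cdf_fin.
apply/cvgrPdist_lt => e e0.
have eK : 0 < e / K by rewrite divr_gt0// /K; lra.
near=> s.
have sr : `|r - s| < e / K by near: s; apply: cvgr_dist_lt => //; exact: cvg_id.
apply: (@le_lt_trans _ _ (K * `|r - s|)); last first.
  by rewrite mulrC -ltr_pdivlMr// /K; lra.
rewrite /=; have [sr'|rs] := leP s r.
  have /andP[lo hi] := normal_cdf_incr sr'.
  by rewrite !ger0_norm ?subr_ge0// /K; nra.
have /andP[lo hi] := normal_cdf_incr (ltW rs).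
rewrite distrC ger0_norm ?subr_ge0// distrC ger0_norm ?subr_ge0 ?ltW// /K.
nra.
Unshelve. all: by end_near.
Qed.

Lemma normal_cdf_near1 (e : R) : 0 < e ->
  exists2 r : R, 0 <= r & 1 - e < fine (Phi r).
Proof.
move=> e0.
have bigcupE : \bigcup_n (`]-oo, n%:R]%classic : set R) = [set: R].
  apply/seteqP; split=> // x _; exists (Num.truncn x).+1 => //=.
  by rewrite in_itv/= ltW// truncnS_gt.
have : Phi n%:R @[n --> \oo] -->
    normal_prob (0 : R) 1 (\bigcup_n (`]-oo, n%:R]%classic : set R)).
  apply: nondecreasing_cvg_mu => [n||m n mn]; first exact: measurable_itv.
    by rewrite bigcupE.
  apply/subsetPset => x /=; rewrite !in_itv/= => /le_trans; apply.
  by rewrite ler_nat.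
rewrite bigcupE probability_setT => /fine_cvg /cvgrPdist_lt /(_ e e0) [N _ HN].
exists N%:R => //.
by have := HN N (leqnn N); rewrite /= ltr_norml; lra.
Qed.

End NormalDistributionFunction.

(** * The branch in which a lazy walk ends up *)

Section Branches.
Variables (R : realType) (fast : F2 -> bool).
Local Notation M := (@step_mean R _ _ (lazy_step fast)).
Local Notation rate := (rate R fast).

(** The words that begin with the generator [i] or its inverse, that is, two of
the four subtrees hanging from the root. *)
Definition in_branch (i : 'I_2) (g : F2) : bool :=
  if word g is a :: _ then a.1 == i else false.

(** A step leaves or enters a branch only through the root, where [F] vanishes. *)
Lemma in_branch_mul_letter i (F : nat -> R) g a : F 0%N = 0 -> len g != 0%N ->
  (in_branch i (g * letter a)%g)%:R * F (len (g * letter a)%g) =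
  (in_branch i g)%:R * F (len (g * letter a)%g).
Proof.
rewrite /in_branch /len => F0.
case gE: (word g) / lastP => [//|u b] _.
rewrite (word_mul_letter_rcons _ gE); case: eqP => _.
  by case: u {gE} => [|c u] //; rewrite F0 !mulr0.
by case: u {gE}.
Qed.

Lemma lazy_mean_branch i (F : nat -> R) g : F 0%N = 0 ->
  M (fun z => (in_branch i z)%:R * F (len z)) g =
  (in_branch i g)%:R * F (len g) + rate g *
    if len g is n.+1 then
      (in_branch i g)%:R * (F n + F n.+2 *+ 3 - F n.+1 *+ 4)
    else F 1%N *+ 2.
Proof.
move=> F0; rewrite lazy_meanE; congr (_ + _ * _).
have [g1|g1] := eqVneq (len g) 0%N.
  have gE : word g = [::] by apply/eqP; rewrite -size_eq0; apply/eqP.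
  rewrite g1 F0 mulr0 mul0rn subr0.
  rewrite (eq_bigr (fun a : letters => (a.1 == i)%:R * F 1%N)); last first.
    by move=> a _; rewrite /in_branch /len (word_mul_letter_nil _ gE).
  rewrite -(pair_bigA _ (fun (j : 'I_2) (_ : bool) => (j == i)%:R * F 1%N)) /=.
  rewrite (bigD1 i) //= eqxx big_bool /= mul1r big1 ?addr0// => j /negPf->.
  by rewrite big1// => c _; rewrite mul0r.
rewrite (eq_bigr _ (fun a _ => in_branch_mul_letter i a F0 g1)) -mulr_sumr.
rewrite sum_letter_len; move: g1; case: (len g) => // n _.
by rewrite -mulrnAr -mulrBr.
Qed.

Lemma in_branch_len0 i g : len g = 0%N -> in_branch i g = false.
Proof. by move=> /eqP; rewrite len_eq0 => /eqP->. Qed.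

Lemma branch_cover g :
  (in_branch ord0 g)%:R + (in_branch ord_max g)%:R = 1 - (len g == 0%N)%:R :> R.
Proof.
rewrite /in_branch /len; case: (word g) => [|[j c] u] /=; first by ring.
have : (j == ord0) = ~~ (j == ord_max).
  by case: j => [[|[|]]].
by move=> ->; case: (_ == _) => /=; ring.
Qed.

(** Since [2^-1 ^+ d] is superharmonic, this bounds from below the probability
that a walk at distance [d] from the root never visits it. *)
Definition escape_bound (d : nat) : R := 1 - 2^-1 ^+ d.

Definition branch_mass i n : R := iter n M (fun z => (in_branch i z)%:R) 1%g.

(** A lower bound for the probability that the walk is in branch [i] at time [n]
and remains there forever. *)
Definition escape_mass i n : R :=
  iter n M (fun z => (in_branch i z)%:R * escape_bound (len z)) 1%g.

Local Notation mass := branch_mass.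

Let card8 : (0 < #|{: bool * letters}|)%N.
Proof. by rewrite card_prod card_bool card_prod card_ord card_bool. Qed.

Lemma iter_half_len_origin n :
  iter n M (fun z => 2^-1 ^+ len z) 1%g <= (15 / 16) ^+ n.
Proof.
apply: le_trans (iter_half_len R fast n 1%g 1%g).
by apply: iter_step_mean_le => z; rewrite invg1 mul1g.
Qed.

Lemma cvg_ratio : ((15 / 16 : R) ^+ n) @[n --> \oo] --> (0 : R).
Proof. by apply: cvg_expr; rewrite ger0_norm; lra. Qed.

Lemma cvg_iter_origin :
  iter n M (fun z => (len z == 0%N)%:R) 1%g @[n --> \oo] --> (0 : R).
Proof.
apply: (squeeze_cvgr _ (cvg_cst 0) cvg_ratio); apply: nearW => n.
rewrite iter_step_mean_ge0 ?ler0n//=.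
apply: le_trans (iter_half_len_origin n); apply: iter_step_mean_le => z.
by case: eqP => [->|_] //; rewrite exprn_ge0.
Qed.

Lemma escape_mass_nondecreasing i :
  {homo escape_mass i : m n / (m <= n)%N >-> m <= n}.
Proof.
apply/nondecreasing_seqP => n; rewrite /escape_mass iterSr.
apply: iter_step_mean_le => z; rewrite (lazy_mean_branch i z); last first.
  by rewrite /escape_bound expr0 subrr.
rewrite lerDl mulr_ge0//.
  by have /andP[] := rate_bounds R fast z; lra.
case: len => [|k]; rewrite /escape_bound; first by rewrite expr1; lra.
rewrite mulr_ge0// !exprS; have : 0 <= 2^-1 ^+ k :> R by rewrite exprn_ge0.
by move: (_ ^+ _) => q; lra.
Qed.

Lemma escape_mass1_ge i : 8^-1 <= escape_mass i 1.
Proof.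
rewrite /escape_mass /= lazy_mean_branch /escape_bound ?expr0 ?subrr//.
rewrite mulr0 add0r /=.
by have /andP[] := rate_bounds R fast 1%g; rewrite expr1; lra.
Qed.

Lemma branch_mass_bounds i n :
  escape_mass i n <= mass i n <= escape_mass i n + (15 / 16) ^+ n.
Proof.
apply/andP; split.
  apply: iter_step_mean_le => z; rewrite ler_piMr// /escape_bound.
  by have : 0 <= 2^-1 ^+ len z :> R; [rewrite exprn_ge0|lra].
apply: (@le_trans _ _ (escape_mass i n + iter n M (fun z => 2^-1 ^+ len z) 1%g)).
  rewrite -iter_step_meanD; apply: iter_step_mean_le => z; rewrite /escape_bound.
  have : 0 <= 2^-1 ^+ len z :> R by rewrite exprn_ge0.
  by case: in_branch => /=; lra.
by rewrite lerD2l iter_half_len_origin.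
Qed.

Lemma branch_mass_le1 i n : mass i n <= 1.
Proof.
rewrite -(iter_step_mean_cst (lazy_step fast) n (1 : R) 1%g card8).
by apply: iter_step_mean_le => z; case: in_branch.
Qed.

(** The probability of being in a branch is not monotone in time, but
[escape_mass] is, and they differ by at most the mean of [2^-1 ^+ len]. *)
Lemma branch_mass_cvg i : exists2 q : R, 8^-1 <= q & mass i n @[n --> \oo] --> q.
Proof.
have cvg_s : escape_mass i n @[n --> \oo] --> sup (range (escape_mass i)).
  apply: nondecreasing_cvgn (@escape_mass_nondecreasing i) _.
  exists 1 => _ [n _ <-]; apply: le_trans (branch_mass_le1 i n).
  by have /andP[] := branch_mass_bounds i n.
exists (sup (range (escape_mass i))).
  apply: (ler_cvg_to (cvg_cst _) cvg_s); near=> n.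
  apply: le_trans (escape_mass1_ge i) _; apply: escape_mass_nondecreasing.
  by near: n; exact: nbhs_infty_ge.
apply: (squeeze_cvgr _ cvg_s).
  by apply: nearW => n; exact: branch_mass_bounds.
rewrite -[X in _ --> X]addr0; exact: cvgD cvg_s cvg_ratio.
Unshelve. all: by end_near.
Qed.

Lemma branch_massD n : mass ord0 n + mass ord_max n =
  1 - iter n M (fun z => (len z == 0%N)%:R) 1%g.
Proof.
apply/eqP; rewrite eq_sym subr_eq /branch_mass -!iter_step_meanD.
rewrite (_ : (fun z => _) = (fun=> 1)) ?iter_step_mean_cst//.
by apply/funext => z; rewrite branch_cover subrK.
Qed.

Lemma branch_mass_total (q0 q1 : R) :
  mass ord0 n @[n --> \oo] --> q0 -> mass ord_max n @[n --> \oo] --> q1 ->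
  q0 + q1 = 1.
Proof.
move=> c0 c1.
have c01 : mass ord0 n + mass ord_max n @[n --> \oo] --> q0 + q1.
  exact: cvgD c0 c1.
have c : mass ord0 n + mass ord_max n @[n --> \oo] --> (1 : R).
  rewrite -[X in _ --> X]subr0; under eq_fun do rewrite branch_massD.
  by apply: cvgB cvg_iter_origin; exact: cvg_cst.
exact: (cvg_unique _ c01 c).
Qed.

End Branches.

(** * A lazy walk with drift and without Central Limit Theorem *)

Lemma cvg_mean (R : realType) (u : nat -> R) (l : R) :
  u n @[n --> \oo] --> l ->
  (\sum_(0 <= k < n) u k) / n%:R @[n --> \oo] --> l.
Proof.
move=> /cesaro ul; rewrite -cvg_shiftS.
rewrite (_ : [sequence _]_n = arithmetic_mean u)//.
by apply/funext => n; rewrite /arithmetic_mean /= seriesEnat mulrC.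
Qed.

Lemma cvg_inv_sqrt (R : realType) :
  (Num.sqrt n%:R)^-1 @[n --> \oo] --> (0 : R).
Proof.
apply/cvgrPdist_lt => e e0; near=> n.
have n0 : (0 < n)%N by near: n; exact: nbhs_infty_gt.
have s0 : 0 < Num.sqrt n%:R :> R by rewrite sqrtr_gt0 ltr0n.
rewrite sub0r normrN gtr0_norm ?invr_gt0// invf_plt ?posrE//.
rewrite -[e^-1]gtr0_norm ?invr_gt0// -sqrtr_sqr ltr_sqrt ?ltr0n//.
  by near: n; exact: nbhs_infty_gtr.
Unshelve. all: by end_near.
Qed.

Section TwoSpeeds.
Variable R : realType.

Local Notation two_speed := (in_branch ord0).
Local Notation M := (@step_mean R _ _ (lazy_step two_speed)).
Local Notation mass := (branch_mass R two_speed).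
Local Notation X := (lazy_walk R two_speed).

Definition branch_speed (i : 'I_2) : R := if i == ord0 then 2^-1 else 4^-1.

Definition branch_len (i : 'I_2) (n : nat) : R :=
  iter n M (fun z => (in_branch i z)%:R * (len z)%:R) 1%g.

(** The mean distance restricted to a branch grows at the speed of the branch
times its current mass, plus the contribution of the visits to the root. *)
Lemma branch_lenE i n : branch_len i n = \sum_(0 <= k < n)
  (branch_speed i * mass i k +
   4^-1 * iter k M (fun z => (len z == 0%N)%:R) 1%g).
Proof.
rewrite /branch_len (@dynkin_eq _ _ _ _ _ _ (fun z =>
  branch_speed i * (in_branch i z)%:R + 4^-1 * (len z == 0%N)%:R)).
  rewrite /= mul0r add0r; apply: eq_bigr => k _.
  by rewrite iter_step_meanD !iter_step_meanZ.
move=> z; rewrite (@lazy_mean_branch _ _ i (fun d => d%:R))//; congr (_ + _).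
have other : i != ord0 -> in_branch i z -> two_speed z = false.
  rewrite /in_branch; case: (word z) => // a _ i0 /eqP->.
  exact: negbTE.
rewrite /rate /branch_speed; case lenz: (len z) => [|d] /=.
  by rewrite !(in_branch_len0 _ lenz) /=; lra.
rewrite -[d.+2%:R]natr1 -[d.+1%:R]natr1.
have [i0|i0] := eqVneq i ord0.
  by rewrite i0; case: (in_branch _ _) => /=; field.
by case iz: (in_branch i z); rewrite ?(other i0 iz) /=; field.
Qed.

Lemma branch_len_cvg i (q : R) : mass i n @[n --> \oo] --> q ->
  branch_len i n / n%:R @[n --> \oo] --> branch_speed i * q.
Proof.
move=> mq; under eq_fun do rewrite branch_lenE.
apply: cvg_mean; rewrite -[branch_speed i * q]addr0.
apply: cvgD; first by apply: cvgM mq; exact: cvg_cst.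
rewrite -[X in _ --> X](mulr0 (4^-1 : R)).
by apply: cvgM; [exact: cvg_cst|exact: cvg_iter_origin].
Qed.

Lemma mean_len_branches n : iter n M (fun z => (len z)%:R) 1%g =
  branch_len ord0 n + branch_len ord_max n.
Proof.
rewrite /branch_len -iter_step_meanD; congr (iter n M _ 1%g).
apply/funext => z; rewrite -mulrDl branch_cover.
by case: eqP => [->|_]; rewrite ?mulr0// subr0 mul1r.
Qed.

Lemma two_speed_drift (q0 q1 : R) :
  mass ord0 n @[n --> \oo] --> q0 -> mass ord_max n @[n --> \oo] --> q1 ->
  drift_is X 1%g (2^-1 * q0 + 4^-1 * q1).
Proof.
move=> /branch_len_cvg c0 /branch_len_cvg c1; apply/drift_isE.
under eq_fun do rewrite mean_len_branches mulrDl.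
exact: cvgD c0 c1.
Qed.

(** The event [Y n <= r] of the Central Limit Theorem says that the distance is
at most [c = l * n + o(n)]; off this event, of probability about [1 - Phi r],
the distance is still at most [n].  On the fast branch this bounds the mean
distance by [c * q0 + n * (1 - Phi r)], up to [o(n)].  Compared with the true
rate [q0 / 2], it gives [(1 / 2 - l) * q0 <= 1 - Phi r], where
[1 / 2 - l = q1 / 4].  The left-hand side is at least 1/256, which is
absurd for large [r]. *)
Lemma two_speed_no_CLT (q0 q1 : R) :
  8^-1 <= q0 -> 8^-1 <= q1 ->
  mass ord0 n @[n --> \oo] --> q0 -> mass ord_max n @[n --> \oo] --> q1 ->
  ~ satisfies_CLT X 1%g (2^-1 * q0 + 4^-1 * q1).
Proof.
move=> q0_ge q1_ge c0 c1; set l := _ + _ => -[sigma sigma0 CLT].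
have q01 := branch_mass_total c0 c1.
have e0 : 0 < 256^-1 :> R by rewrite invr_gt0.
have [r r0 Phir] := normal_cdf_near1 e0.
have {CLT} := CLT r (@normal_cdf_continuous R r).
set p := fine _ in Phir.
pose Y n (z : F2) : R := ((len z)%:R - l * n%:R) / (sigma ^+ 2 * Num.sqrt n%:R).
pose F n := iter n M (fun z => (Y n z <= r)%R%:R) 1%g.
have -> : (fun n => mc_prob X [set t | (dist_start 1%g n t - l * n%:R) /
    (sigma ^+ 2 * Num.sqrt n%:R) <= r]) = (fun n => (F n)%:E).
  apply/funext => n; rewrite /F.
  rewrite -(prob_random_mapping R (false, (ord0, false)) _
    (fun z => (Y n z <= r)%R)).
  congr (mc_prob X _); apply/seteqP; split=> t /=.
    by rewrite dist_start_lazy.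
  by rewrite dist_start_lazy.
have pE : normal_prob (0 : R) 1 `]-oo, r] = p%:E.
  by rewrite /p fineK// normal_cdf_fin.
rewrite [X in _ --> X]pE => /fine_cvg/= FPhi.
have s2 : 0 < sigma ^+ 2 by rewrite exprn_gt0.
have bound n : (0 < n)%N -> branch_len ord0 n / n%:R <=
    (l + r * sigma ^+ 2 * (Num.sqrt n%:R)^-1) * mass ord0 n + (1 - F n).
  move=> n0; have nR : 0 < n%:R :> R by rewrite ltr0n.
  have sn : 0 < Num.sqrt n%:R :> R by rewrite sqrtr_gt0.
  have sE : n%:R = Num.sqrt n%:R * Num.sqrt n%:R :> R.
    by rewrite -expr2 sqr_sqrtr// ltW.
  rewrite ler_pdivrMr// mulrDl.
  (* The threshold for the distance that corresponds to the event [Y n <= r]. *)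
  pose c := (l + r * sigma ^+ 2 * (Num.sqrt n%:R)^-1) * n%:R.
  have cE : c = l * n%:R + r * (sigma ^+ 2 * Num.sqrt n%:R).
    by rewrite /c; move: (Num.sqrt n%:R) sE sn => s -> s0; field; rewrite gt_eqF.
  have c_ge0 : 0 <= c.
    rewrite cE addr_ge0// mulr_ge0//; last by rewrite mulr_ge0 ?ltW.
    by rewrite /l; lra.
  have -> : (l + r * sigma ^+ 2 * (Num.sqrt n%:R)^-1) * mass ord0 n * n%:R +
      (1 - F n) * n%:R =
      iter n M (fun z => (c * (in_branch ord0 z)%:R + n%:R) +
                         (- n%:R) * (Y n z <= r)%R%:R) 1%g.
    rewrite !iter_step_meanD !iter_step_meanZ iter_step_mean_cst; last first.
      by rewrite card_prod card_bool card_prod card_ord card_bool.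
    by rewrite -/(F n) -/(mass ord0 n) /c; ring.
  apply: iter_lazy_mean_le_ball => z; rewrite add0n => zn.
  have zR : (len z)%:R <= n%:R :> R by rewrite ler_nat.
  have zc : Y n z <= r -> (len z)%:R <= c.
    by rewrite /Y ler_pdivrMr ?mulr_gt0// lerBlDr cE addrC.
  have z0 : 0 <= (len z)%:R :> R by [].
  case: (in_branch _ _); case: (Y n z <= r) zc => /= zc; last by lra.
  - by have := zc isT; lra.
  - by lra.
  - by lra.
have lim0 := branch_len_cvg c0.
have lim1 : (l + r * sigma ^+ 2 * (Num.sqrt n%:R)^-1) * mass ord0 n + (1 - F n)
    @[n --> \oo] --> (l + r * sigma ^+ 2 * 0) * q0 + (1 - p).
  apply: cvgD; last by apply: cvgB => //; exact: cvg_cst.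
  apply: cvgM => //; apply: cvgD; first exact: cvg_cst.
  by apply: cvgM; [exact: cvg_cst|exact: cvg_inv_sqrt].
have : branch_speed ord0 * q0 <= (l + r * sigma ^+ 2 * 0) * q0 + (1 - p).
  apply: (ler_cvg_to lim0 lim1); near=> n; apply: bound.
  by near: n; exact: nbhs_infty_gt.
rewrite /branch_speed eqxx mulr0 addr0 /l.
have -> : q1 = 1 - q0 by lra.
nra.
Unshelve. all: by end_near.
Qed.

End TwoSpeeds.

Theorem theorem1 (R : realType) :
  (exists X : markov_chain R F2, tame X /\
     exists o : F2, ~ has_drift X o) /\
  (exists X : markov_chain R F2, tame X /\
     exists (o : F2) (l : R), drift_is X o l /\ ~ satisfies_CLT X o l).
Proof.
split.
  exists (lazy_walk R shell_fast); split; first exact: lazy_tame.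
  by exists 1%g; exact: shell_walk_no_drift.
exists (lazy_walk R (in_branch ord0)); split; first exact: lazy_tame.
have [q0 q0_ge c0] := branch_mass_cvg R (in_branch ord0) ord0.
have [q1 q1_ge c1] := branch_mass_cvg R (in_branch ord0) ord_max.
exists 1%g, (2^-1 * q0 + 4^-1 * q1); split; first exact: two_speed_drift.
exact: two_speed_no_CLT.
Qed.
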